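(* The first-order part of $\mathsf{BS}$ is not Weihrauch reducible to the first-order part of $\mathsf{DS}$, i.e. $\mathrm{FOP}(\mathsf{BS}) \not\le_W \mathrm{FOP}(\mathsf{DS})$. Consequently $\mathsf{DS} <_W \mathsf{BS}$, i.e. $\mathsf{DS} \le_W \mathsf{BS}$ and $\mathsf{BS} \not\le_W \mathsf{DS}$.
   Context: A problem is a partial multivalued function $f:\subseteq \mathbf{X}\rightrightarrows \mathbf{Y}$ between represented spaces (spaces $X$ with a partial surjection $\delta_X:\subseteq \mathbb{N}^\mathbb{N}\to X$; elements of $\delta_X^{-1}(x)$ are names of $x$). $f \le_W g$ (Weihrauch reducibility) means there are computable $\Phi,\Psi:\subseteq\mathbb{N}^\mathbb{N}\to\mathbb{N}^\mathbb{N}$ such that whenever $p$ names some $x\in\mathrm{dom}(f)$, $\Phi(p)$ names some $y\in\mathrm{dom}(g)$, and whenever $q$ names some element of $g(y)$, $\Psi(p,q)$ names an element of $f(x)$. $f<_W g$ means $f\le_W g$ and $g\not\le_W f$. The first-order part $\mathrm{FOP}(f)$ is the $\le_W$-maximum of the problems with codomain $\mathbb{N}$ that are Weihrauch reducible to $f$ (it exists). Countable linear orders and quasi-orders with domain a subset of $\mathbb{N}$ are represented by the characteristic function of $\{\langle n,m\rangle : n\preceq m\}$. $\mathsf{DS}$: given an ill-founded countable linear order, output an infinite descending sequence in it. A sequence $(q_i)$ in a quasi-order $(Q,\preceq)$ is bad if $q_i\not\preceq q_j$ for all $i<j$; $Q$ is a well quasi-order (wqo) if it has no infinite bad sequence.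 $\mathsf{BS}$: given a countable quasi-order that is not a wqo, output an infinite bad sequence in it. *)

(* Defs.v *)
From Stdlib Require Import Arith Cantor.
From Stdlib Require Import FunctionalExtensionality ProofIrrelevance.

Set Implicit Arguments.
Unset Strict Implicit.

Definition baire := nat -> nat.

(** Partial recursive functions with an oracle [p : baire], as unary functions
    over Cantor-coded pairs. *)
Inductive code : Type :=
| Zero | Succ | Left | Right | Oracle
| Pair (c d : code)
| Comp (c d : code)
| Prec (c d : code)
| Mu (c : code).

Notation "⟨ a , b ⟩" := (Cantor.to_nat (a, b)) (format "⟨ a ,  b ⟩").

(** [eval c p x y]: the program [c] with oracle [p] halts on [x] with output
    [y].  For h = Prec c d, h⟨a,0⟩ = c(a) and h⟨a,i+1⟩ = d⟨a,⟨i,h⟨a,i⟩⟩⟩;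
    [Mu c] on [x] searches for the least [y] with c⟨x,y⟩ = 0, and diverges if
    some earlier c⟨x,i⟩ does. *)
Fixpoint eval (c : code) (p : baire) (x y : nat) {struct c} : Prop :=
  match c with
  | Zero => y = 0
  | Succ => y = S x
  | Left => y = fst (Cantor.of_nat x)
  | Right => y = snd (Cantor.of_nat x)
  | Oracle => y = p x
  | Pair c d => exists a b, eval c p x a /\ eval d p x b /\ y = ⟨a, b⟩
  | Comp c d => exists z, eval d p x z /\ eval c p z y
  | Prec c d =>
      let a := fst (Cantor.of_nat x) in
      nat_rect (fun _ => nat -> Prop)
        (eval c p a)
        (fun i graph v => exists u, graph u /\ eval d p ⟨a, ⟨i, u⟩⟩ v)
        (snd (Cantor.of_nat x)) y
  | Mu c =>
      eval c p ⟨x, y⟩ 0 /\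
      forall i, i < y -> exists v, eval c p ⟨x, i⟩ (S v)
  end.

(** A partial function on Baire space, given by its graph [F], is computable
    if one oracle program computes F(p)(n) from [n] for every [p] in the domain
    ([F] is then single-valued, programs being deterministic). *)
Definition computable (F : baire -> baire -> Prop) : Prop :=
  exists c : code, forall p q, F p q -> forall n, eval c p n (q n).

(** Pairing on Baire space by interleaving. *)
Definition join (p q : baire) : baire :=
  fun n => if Nat.even n then p (Nat.div2 n) else q (Nat.div2 n).

(** [names p x] is the graph of the partial surjection δ : [p] is a name of [x]. *)
Record rep_space : Type := RepSpace {
  carrier :> Type;
  names : baire -> carrier -> Prop;
  names_functional : forall p x y, names p x -> names p y -> x = y;
  names_surjective : forall x, exists p, names p x
}.
Arguments names {r} p x.

(** A partial multivalued function, as a relation; its domain consists of the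
    points that have at least one value. *)
Definition problem (X Y : rep_space) : Type := X -> Y -> Prop.

Definition dom (X Y : rep_space) (f : problem X Y) (x : X) : Prop :=
  exists y, f x y.

Definition weihrauch_le (X Y Z W : rep_space)
    (f : problem X Y) (g : problem Z W) : Prop :=
  exists Phi Psi : baire -> baire -> Prop,
    computable Phi /\ computable Psi /\
    forall (p : baire) (x : X), names p x -> dom f x ->
      exists (r : baire) (z : Z), Phi p r /\ names r z /\ dom g z /\
        forall (q : baire) (w : W), names q w -> g z w ->
          exists (s : baire) (y : Y), Psi (join p q) s /\ names s y /\ f x y.

Notation "f ≤W g" := (weihrauch_le f g) (at level 70, no associativity).
Notation "f <W g" := (weihrauch_le f g /\ ~ weihrauch_le g f)
  (at level 70, no associativity).

Program Definition natR : rep_space :=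
  {| carrier := nat; names := fun p n => p 0 = n |}.
Next Obligation. now exists (fun _ => x). Qed.

Program Definition baireR : rep_space :=
  {| carrier := baire; names := fun p q => p = q |}.
Next Obligation. now exists x. Qed.

(** [F] is a first-order part of [f]: a maximum, which is determined up to
    Weihrauch equivalence, among the problems with codomain [natR] reducible
    to [f]. *)
Definition is_FOP (X Y : rep_space) (f : problem X Y)
    (Z : rep_space) (F : problem Z natR) : Prop :=
  F ≤W f /\ forall (V : rep_space) (g : problem V natR), g ≤W f -> g ≤W F.

(** Orders on a subset of [nat], namely the set of [n] with [R n n]. *)
Definition quasi_order (R : nat -> nat -> bool) : Prop :=
  (forall n m, R n m = true -> R n n = true /\ R m m = true) /\
  (forall n m k, R n m = true -> R m k = true -> R n k = true).

Definition linear_order (R : nat -> nat -> bool) : Prop :=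
  quasi_order R /\
  (forall n m, R n m = true -> R m n = true -> n = m) /\
  (forall n m, R n n = true -> R m m = true -> R n m = true \/ R m n = true).

(** [p] is the characteristic function of the set of all ⟨n,m⟩ with [R n m]. *)
Definition char_fun (p : baire) (R : nat -> nat -> bool) : Prop :=
  forall n m, p ⟨n, m⟩ = Nat.b2n (R n m).

Lemma char_fun_functional p R S : char_fun p R -> char_fun p S -> R = S.
Proof.
  intros HR HS; extensionality n; extensionality m.
  apply Nat.b2n_inj; now rewrite <- HR, <- HS.
Qed.

Lemma char_fun_surjective R : exists p, char_fun p R.
Proof.
  exists (fun k => let (n, m) := Cantor.of_nat k in Nat.b2n (R n m)).
  intros n m; now rewrite Cantor.cancel_of_to.
Qed.

Program Definition order_space (P : (nat -> nat -> bool) -> Prop) : rep_space :=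
  {| carrier := {R | P R}; names := fun p R => char_fun p (proj1_sig R) |}.
Next Obligation.
  apply subset_eq_compat; eapply char_fun_functional; eassumption.
Qed.
Next Obligation. apply char_fun_surjective. Qed.

Definition LO : rep_space := order_space linear_order.
Definition QO : rep_space := order_space quasi_order.

Definition descending (R : nat -> nat -> bool) (s : nat -> nat) : Prop :=
  forall i, R (s (S i)) (s i) = true /\ R (s i) (s (S i)) = false.

Definition ill_founded (R : nat -> nat -> bool) : Prop :=
  exists s, descending R s.

Definition bad (R : nat -> nat -> bool) (s : nat -> nat) : Prop :=
  (forall i, R (s i) (s i) = true) /\
  (forall i j, i < j -> R (s i) (s j) = false).

Definition wqo (R : nat -> nat -> bool) : Prop :=
  quasi_order R /\ ~ exists s, bad R s.

Definition DS : problem LO baireR :=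
  fun L s => ill_founded (proj1_sig L) /\ descending (proj1_sig L) s.

Definition BS : problem QO baireR :=
  fun Q s => ~ wqo (proj1_sig Q) /\ bad (proj1_sig Q) s.

(* Main.v *)
Require Import Defs.
From Stdlib Require Import Arith Cantor Lia List.
From Stdlib Require Import FunctionalExtensionality Classical ClassicalEpsilon.

(** If a problem with codomain [nat] reduces to [DS], its solutions can be guessed:
    in an ill-founded linear order the elements starting a descending sequence are
    upward closed, so the finite descending sequence with the greatest last entry,
    among those seen by stage [s] to determine an answer, determines a correct answer
    for all large [s].  No guessing procedure [gamma] works for the problem of finding
    the first element of a bad sequence.  Against [gamma], a quasi-order is built in
    stages together with a list of leaves, ordered by priority.  At each stage a leaf
    above the current guess is split and all leaves of lower priority are merged, so
    that a guess is below almost all elements whenever no leaf of higher priority is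
    split later.  This happens at infinitely many stages, and such a guess does not
    start a bad sequence; but the final order has an infinite bad sequence. *)

(** * Projections of the Cantor pairing *)

Definition left (x : nat) : nat := fst (Cantor.of_nat x).
Definition right (x : nat) : nat := snd (Cantor.of_nat x).

Lemma left_pair a b : left ⟨a, b⟩ = a.
Proof. unfold left; now rewrite Cantor.cancel_of_to. Qed.

Lemma right_pair a b : right ⟨a, b⟩ = b.
Proof. unfold right; now rewrite Cantor.cancel_of_to. Qed.

Lemma pair_left_right x : ⟨left x, right x⟩ = x.
Proof.
  unfold left, right; rewrite <- surjective_pairing; apply Cantor.cancel_to_of.
Qed.

Lemma le_pair a b : a <= ⟨a, b⟩ /\ b <= ⟨a, b⟩.
Proof. pose proof (Cantor.to_nat_non_decreasing a b); lia. Qed.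

(** * Total computable functionals *)

Definition tot (F : baire -> baire) : Prop :=
  exists c, forall p n, eval c p n (F p n).

Lemma tot_ext F G : (forall p n, F p n = G p n) -> tot F -> tot G.
Proof. intros E [c H]; exists c; intros p n; rewrite <- E; apply H. Qed.

Lemma tot_id : tot (fun _ x => x).
Proof.
  exists (Pair Left Right); intros p x; exists (left x), (right x).
  repeat split; symmetry; apply pair_left_right.
Qed.

Lemma tot_oracle A : tot A -> tot (fun p x => p (A p x)).
Proof. intros [c H]; exists (Comp Oracle c); intros p x; now exists (A p x). Qed.

Lemma tot_app F A : tot F -> tot A -> tot (fun p x => F p (A p x)).
Proof.
  intros [c H] [d K]; exists (Comp c d); intros p x; exists (A p x); split; auto.
Qed.

Lemma tot_succ A : tot A -> tot (fun p x => S (A p x)).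
Proof. intros [c H]; exists (Comp Succ c); intros p x; now exists (A p x). Qed.

Lemma tot_const k : tot (fun _ _ => k).
Proof.
  induction k as [|k IH]; [now exists Zero|].
  exact (tot_succ (fun _ _ => k) IH).
Qed.

Lemma tot_left A : tot A -> tot (fun p x => left (A p x)).
Proof. intros [c H]; exists (Comp Left c); intros p x; now exists (A p x). Qed.

Lemma tot_right A : tot A -> tot (fun p x => right (A p x)).
Proof. intros [c H]; exists (Comp Right c); intros p x; now exists (A p x). Qed.

Lemma tot_pair A B : tot A -> tot B -> tot (fun p x => ⟨A p x, B p x⟩).
Proof.
  intros [c H] [d K]; exists (Pair c d); intros p x.
  now exists (A p x), (B p x).
Qed.

Definition tot2 (F : baire -> nat -> nat -> nat) : Prop :=
  tot (fun p x => F p (left x) (right x)).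

Lemma tot_app2 F A B :
  tot2 F -> tot A -> tot B -> tot (fun p x => F p (A p x) (B p x)).
Proof.
  intros HF HA HB.
  apply tot_ext with (2 := tot_app _ _ HF (tot_pair _ _ HA HB)).
  intros p n; now rewrite left_pair, right_pair.
Qed.

(** [Prec] hands its step only the parameter, the index and the previous value, so [x] itself is
    made the parameter and the recursion is run at [⟨x, N p x⟩]. *)
Lemma tot_rect B (G : baire -> nat -> nat -> nat -> nat) N :
  tot B -> tot (fun p t => G p (left t) (left (right t)) (right (right t))) ->
  tot N -> tot (fun p x => nat_rect (fun _ => nat) (B p x) (G p x) (N p x)).
Proof.
  intros [b Hb] [g Hg] HN; destruct (tot_pair _ _ tot_id HN) as [n Hn].
  exists (Comp (Prec b g) n); intros p x; exists ⟨x, N p x⟩; split; [apply Hn|].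
  cbn [eval]; fold (left ⟨x, N p x⟩) (right ⟨x, N p x⟩).
  rewrite left_pair, right_pair.
  induction (N p x) as [|k IH]; cbn [nat_rect]; [apply Hb|].
  eexists; split; [exact IH|].
  match goal with |- eval _ _ ?a _ => pose proof (Hg p a) as H end.
  now rewrite ?right_pair, ?left_pair in H.
Qed.

(** A case distinction is a primitive recursion whose step discards the previous value. *)
Lemma tot_case N A (G : baire -> nat -> nat -> nat) :
  tot N -> tot A -> tot2 G ->
  tot (fun p x => match N p x with 0 => A p x | S u => G p x u end).
Proof.
  intros HN HA HG.
  assert (H : tot (fun p x =>
    nat_rect (fun _ => nat) (A p x) (fun i _ => G p x i) (N p x))).
  { apply tot_rect with (G := fun p x i _ => G p x i); auto.
    apply (tot_app2 G); [exact HG | |]; repeat apply tot_left.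
    - apply tot_id.
    - apply tot_right, tot_id. }
  apply tot_ext with (2 := H); intros p x; now destruct (N p x).
Qed.

Lemma tot_if N A B :
  tot N -> tot A -> tot B ->
  tot (fun p x => match N p x with 0 => A p x | S _ => B p x end).
Proof.
  intros HN HA HB; apply (tot_case N A (fun p x _ => B p x)); auto.
  apply (tot_app B); [exact HB | apply tot_left, tot_id].
Qed.

Lemma tot_pred A : tot A -> tot (fun p x => Nat.pred (A p x)).
Proof.
  intros HA.
  apply tot_ext with (F := fun p x => match A p x with 0 => 0 | S u => u end).
  { intros p x; now destruct (A p x). }
  apply (tot_case A (fun _ _ => 0) (fun _ _ u => u)); auto.
  - apply tot_const.
  - apply tot_right, tot_id.
Qed.

Lemma tot_sub A B : tot A -> tot B -> tot (fun p x => A p x - B p x).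
Proof.
  intros HA HB.
  assert (H : tot (fun p x =>
    nat_rect (fun _ => nat) (A p x) (fun _ u => Nat.pred u) (B p x))).
  { apply tot_rect with (G := fun _ _ _ u => Nat.pred u); auto.
    apply tot_pred, tot_right, tot_right, tot_id. }
  apply tot_ext with (2 := H); intros p x.
  induction (B p x) as [|b IH]; cbn [nat_rect]; [|rewrite IH]; lia.
Qed.

Lemma tot_double A : tot A -> tot (fun p x => 2 * A p x).
Proof.
  intros HA.
  assert (H : tot (fun p x =>
    nat_rect (fun _ => nat) 0 (fun _ u => S (S u)) (A p x))).
  { apply tot_rect with (B := fun _ _ => 0) (G := fun _ _ _ u => S (S u)); auto.
    - apply tot_const.
    - apply tot_succ, tot_succ, tot_right, tot_right, tot_id. }
  apply tot_ext with (2 := H); intros p x.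
  induction (A p x) as [|b IH]; cbn [nat_rect]; [|rewrite IH]; lia.
Qed.

Lemma tot_even A : tot A -> tot (fun p x => Nat.b2n (Nat.even (A p x))).
Proof.
  intros HA.
  assert (H : tot (fun p x =>
    nat_rect (fun _ => nat) 1 (fun _ u => 1 - u) (A p x))).
  { apply tot_rect with (B := fun _ _ => 1) (G := fun _ _ _ u => 1 - u); auto.
    - apply tot_const.
    - apply tot_sub; [apply tot_const | apply tot_right, tot_right, tot_id]. }
  apply tot_ext with (2 := H); intros p x.
  induction (A p x) as [|b IH]; cbn [nat_rect]; [reflexivity|].
  rewrite IH, Nat.even_succ, <- Nat.negb_even; now destruct (Nat.even b).
Qed.

Lemma tot_div2 A : tot A -> tot (fun p x => Nat.div2 (A p x)).
Proof.
  intros HA.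
  (* [div2] grows exactly in passing from an odd [i] to [S i]. *)
  set (G := fun i u => match Nat.b2n (Nat.even i) with 0 => S u | S _ => u end).
  assert (H : tot (fun p x => nat_rect (fun _ => nat) 0 G (A p x))).
  { apply tot_rect with (B := fun _ _ => 0) (G := fun _ _ i u => G i u); auto.
    - apply tot_const.
    - apply tot_if.
      + apply tot_even, tot_left, tot_right, tot_id.
      + apply tot_succ, tot_right, tot_right, tot_id.
      + apply tot_right, tot_right, tot_id. }
  apply tot_ext with (2 := H); intros p x.
  induction (A p x) as [|b IH]; cbn [nat_rect]; [reflexivity|].
  rewrite IH; unfold G; destruct (Nat.even b) eqn:E; cbn [Nat.b2n].
  - apply Nat.even_spec in E as [m ->].
    now rewrite Nat.div2_succ_double, Nat.div2_double.
  - assert (O : Nat.odd b = true) by now rewrite <- Nat.negb_even, E.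
    apply Nat.odd_spec in O as [m ->].
    rewrite (Nat.add_comm _ 1); change (1 + 2 * m) with (S (2 * m)).
    rewrite Nat.div2_succ_double; cbn [Nat.div2]; now rewrite Nat.div2_double.
Qed.

(** * The two halves of an interleaved sequence *)

Lemma join_even p q n : join p q (2 * n) = p n.
Proof.
  unfold join; rewrite Nat.div2_double.
  now rewrite (proj2 (Nat.even_spec (2 * n)) (ex_intro _ n eq_refl)).
Qed.

Lemma join_odd p q n : join p q (S (2 * n)) = q n.
Proof.
  unfold join; rewrite Nat.div2_succ_double, Nat.even_succ, <- Nat.negb_even.
  now rewrite (proj2 (Nat.even_spec (2 * n)) (ex_intro _ n eq_refl)).
Qed.

Definition evens (p : baire) : baire := fun n => p (2 * n).
Definition odds (p : baire) : baire := fun n => p (S (2 * n)).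

Lemma evens_join p q : evens (join p q) = p.
Proof. extensionality n; apply join_even. Qed.

Lemma odds_join p q : odds (join p q) = q.
Proof. extensionality n; apply join_odd. Qed.

Lemma tot_evens : tot evens.
Proof. apply (tot_oracle (fun _ n => 2 * n)), tot_double, tot_id. Qed.

Lemma tot_odds : tot odds.
Proof. apply (tot_oracle (fun _ n => S (2 * n))), tot_succ, tot_double, tot_id. Qed.

Lemma tot_join (F G : baire -> nat -> nat -> nat) A :
  tot2 F -> tot2 G -> tot A ->
  tot (fun p x => join (F p x) (G p x) (A p x)).
Proof.
  intros HF HG HA.
  apply tot_ext with
    (F := fun p x => match Nat.b2n (Nat.even (A p x)) with
                     | 0 => G p x (Nat.div2 (A p x))
                     | S _ => F p x (Nat.div2 (A p x)) end).
  { intros p x; unfold join; now destruct (Nat.even (A p x)). }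
  apply tot_if; [now apply tot_even | apply (tot_app2 G) | apply (tot_app2 F)];
    auto using tot_id, tot_div2.
Qed.

(** * Computable operators *)

Lemma computable_fun F : tot F -> computable (fun p q => q = F p).
Proof. intros [c Hc]; exists c; intros p q ->; apply Hc. Qed.

Fixpoint subst_oracle (c o : code) : code :=
  match c with
  | Oracle => o
  | Pair c d => Pair (subst_oracle c o) (subst_oracle d o)
  | Comp c d => Comp (subst_oracle c o) (subst_oracle d o)
  | Prec c d => Prec (subst_oracle c o) (subst_oracle d o)
  | Mu c => Mu (subst_oracle c o)
  | _ => c
  end.

Lemma eval_subst_oracle o p r :
  (forall n, eval o p n (r n)) ->
  forall c x y, eval c r x y -> eval (subst_oracle c o) p x y.
Proof.
  intros Ho c; induction c as [| | | | |c IHc d IHd|c IHc d IHd|c IHc d IHd|c IHc];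
    intros x y; cbn [eval subst_oracle]; auto.
  - intros ->; apply Ho.
  - intros (a & b & Ha & Hb & ->); exists a, b; auto.
  - intros (z & Hz & Hy); exists z; auto.
  - revert y; induction (snd (Cantor.of_nat x)) as [|n IH]; intros y; cbn [nat_rect].
    + apply IHc.
    + intros (u & Hu & Hy); exists u; auto.
  - intros [H0 Hlt]; split; [auto|].
    intros i Hi; destruct (Hlt i Hi) as [v Hv]; exists v; auto.
Qed.

(** The second program is run with its oracle queries answered by the first. *)
Lemma computable_comp (A B : baire -> baire -> Prop) :
  computable A -> computable B ->
  computable (fun p s => exists r, A p r /\ B r s).
Proof.
  intros [a Ha] [b Hb]; exists (subst_oracle b a); intros p s (r & Hr & Hs) n.
  apply eval_subst_oracle with (r := r); [now apply Ha | now apply Hb].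
Qed.

Lemma computable_join (A B : baire -> baire -> Prop) :
  computable A -> computable B ->
  computable (fun p s => exists q r, A p q /\ B p r /\ s = join q r).
Proof.
  intros [a Ha] [b Hb].
  destruct (tot_even _ tot_id) as [e He], (tot_div2 _ tot_id) as [h Hh].
  assert (Hsel : tot (fun _ t =>
    match left t with 0 => right (right t) | S _ => left (right t) end)).
  { apply tot_if; auto using tot_left, tot_right, tot_id. }
  destruct Hsel as [sel Hsel].
  (* Both programs are run at [div2 n] before the parity selects a value; both runs halt since [q]
     and [r] are total. *)
  exists (Comp sel (Pair e (Pair (Comp a h) (Comp b h)))).
  intros p s (q & r & Hq & Hr & ->) n.
  eexists; split.
  - eexists; eexists; split; [apply He | split; [|reflexivity]].
    eexists; eexists; split; [|split; [|reflexivity]];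
      (eexists; split; [apply Hh |]); [apply (Ha _ _ Hq) | apply (Hb _ _ Hr)].
  - match goal with |- eval _ _ ?a _ => pose proof (Hsel p a) as H end.
    rewrite ?right_pair, ?left_pair in H; unfold join.
    now destruct (Nat.even n).
Qed.

Lemma weihrauch_le_trans X Y Z W U V
    (f : problem X Y) (g : problem Z W) (h : problem U V) :
  f ≤W g -> g ≤W h -> f ≤W h.
Proof.
  intros (A & B & HA & HB & Hfg) (C & D & HC & HD & Hgh).
  exists (fun p s => exists r, A p r /\ C r s).
  (* The backward operator gets [m = join p q]: it recomputes the instance [u] of [g] from [p], lets
     [D] turn [join u q] into a solution [r] of that instance, and gives [join p r] to [B]. *)
  exists (fun m s => exists t, (exists p r, p = evens m /\
    (exists k, (exists u v, (exists p', p' = evens m /\ A p' u) /\ v = odds m /\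
      k = join u v) /\ D k r) /\ t = join p r) /\ B t s).
  split; [now apply computable_comp|split].
  - apply computable_comp; [|assumption].
    apply computable_join with (A := fun m p => p = evens m);
      [apply computable_fun, tot_evens|].
    apply computable_comp with
      (A := fun m k => exists u v, (exists p', p' = evens m /\ A p' u) /\
        v = odds m /\ k = join u v); [|assumption].
    apply computable_join with
      (A := fun m u => exists p', p' = evens m /\ A p' u) (B := fun m v => v = odds m);
      [|apply computable_fun, tot_odds].
    apply computable_comp with (A := fun m p' => p' = evens m); [|assumption].
    apply computable_fun, tot_evens.
  - intros p x Hp Hx.
    destruct (Hfg p x Hp Hx) as (r & z & Hr & Hrz & Hz & Hfg').
    destruct (Hgh r z Hrz Hz) as (s & u & Hs & Hsu & Hu & Hgh').
    exists s, u; split; [now exists r|split; [assumption|split; [assumption|]]].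
    intros q v Hqv Hv; destruct (Hgh' q v Hqv Hv) as (t & w & Ht & Htw & Hw).
    destruct (Hfg' t w Htw Hw) as (s' & y & Hs' & Hy & Hxy).
    exists s', y; split; [|now split].
    exists (join p t); split; [|assumption].
    exists p, t; rewrite evens_join, odds_join.
    repeat split; exists (join r q); split; [|assumption].
    exists r, q; repeat split; now exists p.
Qed.

(** * Bounded evaluation *)

(** [ev c p k x] is [S y] if the computation of [c] on [x] with oracle [p] yields
    [y] making only oracle queries below [k] and unbounded searches below [k], and
    [0] otherwise.  The state of a search is [0] while it is running, [1] when it is
    aborted, and [S (S i)] once it has found [i]. *)
Fixpoint ev (c : code) (p : baire) (k x : nat) {struct c} : nat :=
  match c with
  | Zero => 1
  | Succ => S (S x)
  | Left => S (left x)
  | Right => S (right x)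
  | Oracle => match k - x with 0 => 0 | S _ => S (p x) end
  | Pair c d =>
      match ev c p k x with
      | 0 => 0
      | S a => match ev d p k x with 0 => 0 | S b => S ⟨a, b⟩ end
      end
  | Comp c d => match ev d p k x with 0 => 0 | S z => ev c p k z end
  | Prec c d =>
      nat_rect (fun _ => nat) (ev c p k (left x))
        (fun i r => match r with 0 => 0 | S u => ev d p k ⟨left x, ⟨i, u⟩⟩ end)
        (right x)
  | Mu c =>
      Nat.pred (nat_rect (fun _ => nat) 0
        (fun i r => match r with
                    | 0 => match ev c p k ⟨x, i⟩ with
                           | 0 => 1
                           | S v => match v with 0 => S (S i) | S _ => 0 end
                           end
                    | S r' => S r'
                    end) k)
  end.

Lemma search_spec (f : nat -> nat) k y :
  Nat.pred (nat_rect (fun _ => nat) 0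
    (fun i r => match r with
                | 0 => match f i with
                       | 0 => 1
                       | S v => match v with 0 => S (S i) | S _ => 0 end
                       end
                | S r' => S r'
                end) k) = S y <->
  y < k /\ f y = 1 /\ forall i, i < y -> exists v, f i = S (S v).
Proof.
  set (g := fun i r => match r with
                | 0 => match f i with
                       | 0 => 1
                       | S v => match v with 0 => S (S i) | S _ => 0 end
                       end
                | S r' => S r'
                end).
  set (st := nat_rect (fun _ => nat) 0 g).
  (* Either all outputs so far are positive, or the search has stopped at the first [i] where the
     output is missing ([f i = 0]) or zero ([f i = 1]). *)
  assert (H : (st k = 0 /\ forall i, i < k -> exists v, f i = S (S v)) \/
    (exists i, i < k /\ (forall j, j < i -> exists v, f j = S (S v)) /\
      (st k = 1 /\ f i = 0 \/ st k = S (S i) /\ f i = 1))).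
  { induction k as [|k IH]; [left; split; [reflexivity|lia]|].
    change (st (S k)) with (g k (st k)).
    destruct IH as [[E H]|(i & Hi & H & E)].
    - rewrite E; cbn [g].
      destruct (f k) as [|[|v]] eqn:F.
      + right; exists k; auto.
      + right; exists k; auto.
      + left; split; [reflexivity|]; intros i Hi.
        assert (i < k \/ i = k) as [L| ->] by lia; eauto.
    - right; exists i; split; [lia|split; [assumption|]].
      destruct E as [[-> E]|[-> E]]; cbn [g]; auto. }
  destruct H as [[E H]|(i & Hi & H & E)].
  - rewrite E; cbn [Nat.pred]; split; [discriminate|].
    intros (Hy & Fy & _); destruct (H y Hy) as [v Hv]; congruence.
  - destruct E as [[-> E]|[-> E]]; cbn [Nat.pred]; (split; [intros K|intros (Hy & Fy & K)]).
    + discriminate.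
    + destruct (Nat.lt_trichotomy i y) as [L|[->|L]].
      * destruct (K i L); congruence.
      * congruence.
      * destruct (H y L); congruence.
    + injection K as <-; auto.
    + destruct (Nat.lt_trichotomy i y) as [L|[->|L]].
      * destruct (K i L); congruence.
      * congruence.
      * destruct (H y L); congruence.
Qed.

Lemma ev_local c p q k x :
  (forall i, i < k -> p i = q i) -> ev c p k x = ev c q k x.
Proof.
  intros E; revert x.
  induction c as [| | | | |c IHc d IHd|c IHc d IHd|c IHc d IHd|c IHc];
    intros x; cbn [ev]; auto.
  - destruct (k - x) eqn:K; [reflexivity|]; rewrite E by lia; reflexivity.
  - now rewrite IHc, IHd.
  - rewrite IHd; destruct (ev d q k x); auto.
  - induction (right x) as [|n IH]; cbn [nat_rect]; [apply IHc|].
    rewrite IH; match goal with |- match ?u with _ => _ end = _ => destruct u end; auto.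
  - do 2 f_equal; extensionality i; extensionality r; now rewrite IHc.
Qed.

Lemma ev_mono c p k l x y : k <= l -> ev c p k x = S y -> ev c p l x = S y.
Proof.
  intros L; revert x y.
  induction c as [| | | | |c IHc d IHd|c IHc d IHd|c IHc d IHd|c IHc];
    intros x y; cbn [ev]; auto.
  - destruct (k - x) eqn:K; [discriminate|].
    destruct (l - x) eqn:K'; [lia|auto].
  - destruct (ev c p k x) as [|a] eqn:A; [discriminate|].
    destruct (ev d p k x) as [|b] eqn:B; [discriminate|].
    now rewrite (IHc _ _ A), (IHd _ _ B).
  - destruct (ev d p k x) as [|b] eqn:B; [discriminate|].
    rewrite (IHd _ _ B); auto.
  - revert y; induction (right x) as [|n IH]; intros y; cbn [nat_rect]; [apply IHc|].
    match goal with |- match ?u with _ => _ end = _ -> _ => destruct u end; [discriminate|].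
    rewrite (IH _ eq_refl); auto.
  - rewrite !search_spec; intros (Hy & H0 & H); repeat split; [lia|auto|].
    intros i Hi; destruct (H i Hi) as [v Hv]; exists v; auto.
Qed.

Lemma ev_sound c p k x y : ev c p k x = S y -> eval c p x y.
Proof.
  revert x y.
  induction c as [| | | | |c IHc d IHd|c IHc d IHd|c IHc d IHd|c IHc];
    intros x y; cbn [ev eval]; try (intros [= <-]; reflexivity).
  - destruct (k - x); [discriminate|congruence].
  - destruct (ev c p k x) as [|a] eqn:A; [discriminate|].
    destruct (ev d p k x) as [|b] eqn:B; [discriminate|].
    intros [= <-]; exists a, b; auto.
  - destruct (ev d p k x) as [|b] eqn:B; [discriminate|]; exists b; auto.
  - fold (left x) (right x); revert y.
    induction (right x) as [|n IH]; intros y; cbn [nat_rect]; [apply IHc|].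
    match goal with |- match ?u with _ => _ end = _ -> _ => destruct u end; [discriminate|].
    intros E; eexists; split; [now apply IH|auto].
  - rewrite search_spec; intros (Hy & H0 & H); split; [auto|].
    intros i Hi; destruct (H i Hi) as [v Hv]; exists v; auto.
Qed.

Lemma bounded_uniform (P : nat -> nat -> Prop) n :
  (forall i k l, k <= l -> P i k -> P i l) ->
  (forall i, i < n -> exists k, P i k) -> exists k, forall i, i < n -> P i k.
Proof.
  intros M; induction n as [|n IH]; intros H; [exists 0; lia|].
  destruct IH as [k Hk]; [auto|]; destruct (H n) as [l Hl]; [lia|].
  exists (k + l); intros i Hi; assert (i < n \/ i = n) as [L| ->] by lia.
  - apply M with k; [lia|auto].
  - apply M with l; [lia|auto].
Qed.

Lemma ev_complete c p x y : eval c p x y -> exists k, ev c p k x = S y.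
Proof.
  revert x y.
  induction c as [| | | | |c IHc d IHd|c IHc d IHd|c IHc d IHd|c IHc];
    intros x y; cbn [ev eval]; try (intros ->; exists 0; reflexivity).
  - intros ->; exists (S x); now replace (S x - x) with 1 by lia.
  - intros (a & b & Ha & Hb & ->).
    destruct (IHc _ _ Ha) as [k Hk], (IHd _ _ Hb) as [l Hl]; exists (k + l).
    rewrite (ev_mono c p k (k + l) x a), (ev_mono d p l (k + l) x b); auto; lia.
  - intros (z & Hz & Hy).
    destruct (IHc _ _ Hy) as [k Hk], (IHd _ _ Hz) as [l Hl]; exists (k + l).
    rewrite (ev_mono d p l (k + l) x z); auto; [|lia].
    apply ev_mono with k; auto; lia.
  (* The claim is made for all [l >= k] because [ev_mono] speaks of codes and not of the unfolded
     recursion at an intermediate [n]. *)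
  - enough (H : forall n y, nat_rect (fun _ => nat -> Prop) (eval c p (left x))
        (fun i graph v => exists u, graph u /\ eval d p ⟨left x, ⟨i, u⟩⟩ v) n y ->
      exists k, forall l, k <= l -> nat_rect (fun _ => nat) (ev c p l (left x))
        (fun i r => match r with 0 => 0 | S u => ev d p l ⟨left x, ⟨i, u⟩⟩ end) n = S y).
    { intros E; destruct (H _ _ E) as [k Hk]; exists k; apply Hk; lia. }
    intros n; induction n as [|n IH]; intros v; cbn [nat_rect].
    + intros E; destruct (IHc _ _ E) as [k Hk]; exists k; intros l L.
      now apply ev_mono with k.
    + intros (u & Hu & E); destruct (IH _ Hu) as [k Hk], (IHd _ _ E) as [k' Hk'].
      exists (k + k'); intros l L; rewrite Hk by lia.
      apply ev_mono with k'; auto; lia.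
  - intros [H0 H]; destruct (IHc _ _ H0) as [k Hk].
    destruct (bounded_uniform (fun i k => exists v, ev c p k ⟨x, i⟩ = S (S v)) y)
      as [l Hl].
    { intros i a b L [v Hv]; exists v; now apply ev_mono with a. }
    { intros i Hi; destruct (H i Hi) as [v Hv]; destruct (IHc _ _ Hv) as [l Hl].
      now exists l, v. }
    exists (S y + k + l); rewrite search_spec; repeat split; [lia| |].
    + apply ev_mono with k; auto; lia.
    + intros i Hi; destruct (Hl i Hi) as [v Hv]; exists v.
      apply ev_mono with l; auto; lia.
Qed.

(** Both computations are completed under a common bound, where [ev] is a function. *)
Lemma eval_det c p x y z : eval c p x y -> eval c p x z -> y = z.
Proof.
  intros Hy Hz; destruct (ev_complete _ _ _ _ Hy) as [k Hk].
  destruct (ev_complete _ _ _ _ Hz) as [l Hl].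
  apply ev_mono with (l := k + l) in Hk; [|lia].
  apply ev_mono with (l := k + l) in Hl; [|lia].
  congruence.
Qed.

(** Lets a reduction compute tables of bounded runs of a fixed program. Oracle and bound may vary
    with [e], since the runs are made against decoded finite sequences. *)
Lemma tot_ev c O K :
  tot2 O -> tot K -> tot2 (fun p e x => ev c (O p e) (K p e) x).
Proof.
  intros HO HK; pose proof tot_id as I.
  induction c as [| | | | |c IHc d IHd|c IHc d IHd|c IHc d IHd|c IHc];
    unfold tot2; cbn [ev].
  - apply tot_const.
  - auto using tot_succ, tot_right.
  - auto using tot_succ, tot_right, tot_left.
  - auto using tot_succ, tot_right.
  - apply tot_if; [apply tot_sub; [apply (tot_app K)|]| |];
      auto using tot_left, tot_right, tot_const.
    apply tot_succ; exact HO.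
  - apply (tot_case _ _ (fun p x a =>
      match ev d (O p (left x)) (K p (left x)) (right x) with
      | 0 => 0 | S b => S ⟨a, b⟩ end)); [exact IHc|apply tot_const|].
    apply (tot_case _ _ (fun p x b => S ⟨right x, b⟩)); [|apply tot_const|].
    + apply (tot_app2 (fun p e x => ev d (O p e) (K p e) x));
        auto using tot_left, tot_right.
    + apply tot_succ, tot_pair; auto using tot_left, tot_right.
  - apply (tot_case _ _ (fun p x z => ev c (O p (left x)) (K p (left x)) z));
      [exact IHd|apply tot_const|].
    apply (tot_app2 (fun p e x => ev c (O p e) (K p e) x));
      auto using tot_left, tot_right.
  - apply tot_rect with
      (B := fun p x => ev c (O p (left x)) (K p (left x)) (left (right x)))
      (G := fun p x i r => match r with 0 => 0 | S u =>
        ev d (O p (left x)) (K p (left x)) ⟨left (right x), ⟨i, u⟩⟩ end).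
    + apply (tot_app2 (fun p e x => ev c (O p e) (K p e) x));
        auto using tot_left, tot_right.
    + apply (tot_case _ _ (fun p t u =>
        ev d (O p (left (left t))) (K p (left (left t)))
          ⟨left (right (left t)), ⟨left (right t), u⟩⟩));
        auto using tot_right, tot_const.
      apply (tot_app2 (fun p e x => ev d (O p e) (K p e) x));
        auto 10 using tot_left, tot_right, tot_pair.
    + auto using tot_right.
  - apply tot_pred, tot_rect with
      (B := fun _ _ => 0)
      (G := fun p x i r => match r with
                    | 0 => match ev c (O p (left x)) (K p (left x)) ⟨right x, i⟩ with
                           | 0 => 1
                           | S v => match v with 0 => S (S i) | S _ => 0 end
                           end
                    | S r' => S r'
                    end).
    + apply tot_const.
    + apply (tot_case _ _ (fun _ _ r => S r));
        [auto using tot_right| |apply tot_succ, tot_right, I].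
      apply (tot_case _ _ (fun _ t v => match v with 0 => S (S (left (right t))) | S _ => 0 end));
        [|apply tot_const|].
      * apply (tot_app2 (fun p e x => ev c (O p e) (K p e) x));
          auto using tot_left, tot_right, tot_pair.
      * apply tot_if; auto 10 using tot_left, tot_right, tot_succ, tot_const.
    + apply (tot_app K); auto using tot_left.
Qed.

(** * Finite sequences *)

(** Entries are appended on the right, so the code of a prefix is reached by iterating [left]. The
    length is not part of the code and is carried alongside. *)
Definition pack (q : baire) (n : nat) : nat :=
  nat_rect (fun _ => nat) 0 (fun i c => ⟨c, q i⟩) n.

Definition unpack (n c : nat) : baire :=
  fun i => right (nat_rect (fun _ => nat) c (fun _ u => left u) (n - S i)).

Lemma unpack_pack q n i : i < n -> unpack n (pack q n) i = q i.
Proof.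
  intros Hi; unfold unpack.
  assert (H : forall d m, nat_rect (fun _ => nat) (pack q (d + m)) (fun _ u => left u) d
    = pack q m).
  { induction d as [|d IH]; intros m; [reflexivity|].
    cbn [nat_rect]; rewrite Nat.add_succ_comm, IH; apply left_pair. }
  replace (pack q n) with (pack q ((n - S i) + S i)) by (f_equal; lia).
  rewrite H; apply right_pair.
Qed.

Lemma tot_unpack N C A :
  tot N -> tot C -> tot A -> tot (fun p x => unpack (N p x) (C p x) (A p x)).
Proof.
  intros HN HC HA; apply tot_right, (tot_rect _ (fun _ _ _ u => left u)); auto.
  - apply tot_left, tot_right, tot_right, tot_id.
  - apply tot_sub; auto using tot_succ.
Qed.

(** * First-order parts *)

Lemma join_agree p q r n :
  (forall i, i < n -> q i = r i) -> forall i, i < 2 * n -> join p q i = join p r i.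
Proof.
  intros E i Hi; unfold join; destruct (Nat.even i); [reflexivity|].
  apply E; rewrite Nat.div2_div; apply Nat.Div0.div_lt_upper_bound; lia.
Qed.

Lemma computable_search E :
  tot E -> computable (fun m s => exists n v,
    E m n = S v /\ (forall i, i < n -> E m i = 0) /\ s = fun _ => v).
Proof.
  intros HE.
  destruct (tot_pred _ HE) as [d Hd].
  (* [Mu] searches for a zero, so the test exchanges zero and nonzero values of [E]. *)
  destruct (tot_if (fun m t => E m (right t)) (fun _ _ => 1) (fun _ _ => 0))
    as [c Hc]; auto using tot_const.
  { apply (tot_app E); auto using tot_right, tot_id. }
  exists (Comp d (Mu c)); intros m s (n & v & Hn & Hlt & ->) k.
  exists n; split.
  - split.
    + specialize (Hc m ⟨k, n⟩); now rewrite right_pair, Hn in Hc.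
    + intros i Hi; exists 0; specialize (Hc m ⟨k, i⟩).
      now rewrite right_pair, Hlt in Hc.
  - specialize (Hd m n); now rewrite Hn in Hd.
Qed.

(** An instance consists of a name of an instance of [f] together with a table [a]
    such that every name [q] of a solution has a prefix to which [a] assigns a value,
    coded by its successor; the answer is the value at the shortest such prefix of
    some [q]. *)
Definition fop (X Y : rep_space) (f : problem X Y) : problem baireR natR :=
  fun u v => exists x, names (odds u) x /\ dom f x /\
    (forall q w, names q w -> f x w -> exists n, evens u ⟨n, pack q n⟩ <> 0) /\
    exists q w n, names q w /\ f x w /\ evens u ⟨n, pack q n⟩ = S v /\
      forall i, i < n -> evens u ⟨i, pack q i⟩ = 0.

Arguments fop {X Y} f.

Lemma least_witness (P : nat -> Prop) :
  (exists n, P n) -> exists n, P n /\ forall i, i < n -> ~ P i.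
Proof.
  intros [n Hn]; revert Hn; induction n as [n IH] using (well_founded_induction lt_wf).
  intros Hn; destruct (classic (exists i, i < n /\ P i)) as [(i & Hi & Pi)|H].
  - now apply (IH i).
  - exists n; split; [assumption|]; intros i Hi Pi; apply H; now exists i.
Qed.

(** The backward operator follows the table along the prefixes of the given solution up to the first
    nonzero entry. *)
Lemma fop_le X Y (f : problem X Y) : fop f ≤W f.
Proof.
  exists (fun u r => r = odds u), (fun m s => exists n v,
    evens (evens m) ⟨n, pack (odds m) n⟩ = S v /\
    (forall i, i < n -> evens (evens m) ⟨i, pack (odds m) i⟩ = 0) /\ s = fun _ => v).
  split; [apply computable_fun, tot_odds|split].
  - apply (computable_search (fun m n => evens (evens m) ⟨n, pack (odds m) n⟩)).
    unfold evens; apply tot_oracle, tot_double, tot_double, tot_pair; [apply tot_id|].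
    apply (tot_rect _ (fun m _ i c => ⟨c, odds m i⟩)); auto using tot_const, tot_id.
    apply tot_pair; [|apply (tot_app odds); [apply tot_odds|]];
      auto using tot_left, tot_right, tot_id.
  - intros u u' Hu; cbn in Hu; subst u'; intros (v & x & Hx & Dx & Hq & _).
    exists (odds u), x; repeat split; auto.
    intros q w Hw Hf.
    destruct (least_witness (fun n => evens u ⟨n, pack q n⟩ <> 0)) as (n & Hn & Hlt);
      [eauto|].
    destruct (evens u ⟨n, pack q n⟩) as [|y] eqn:E; [now destruct Hn|].
    assert (Hz : forall i, i < n -> evens u ⟨i, pack q i⟩ = 0).
    { intros i Hi; specialize (Hlt i Hi).
      destruct (evens u ⟨i, pack q i⟩); [reflexivity|now destruct Hlt]. }
    exists (fun _ => y), y; split; [|split; [reflexivity|]].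
    + exists n, y; rewrite evens_join, odds_join; auto.
    + exists x; repeat split; auto; now exists q, w, n.
Qed.

(** The table stores, for each finite sequence, the result of a bounded run of the backward program
    on [p] joined with it. An entry met along a solution is a correct answer, because the run does
    not look beyond the prefix; every solution meets an entry, because the run on it halts. *)
Lemma le_fop X Y (f : problem X Y) V (g : problem V natR) : g ≤W f -> g ≤W fop f.
Proof.
  intros (A & B & HA & [c Hc] & H).
  set (O := fun (p : baire) e => join p (unpack (left e) (right e))).
  (* [n] entries of the sequence fix the first [2 * n] entries of the join. The argument is [0]
     because a number is named by the entry at [0]. *)
  set (table := fun (p : baire) e => ev c (O p e) (2 * left e) 0).
  assert (HO : tot2 O).
  { apply (tot_join (fun p _ n => p n)
        (fun _ x n => unpack (left (left x)) (right (left x)) n) (fun _ x => right x));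
      [apply (tot_oracle (fun _ x => right x))|apply tot_unpack|];
      auto using tot_left, tot_right, tot_id. }
  assert (Ht : tot table).
  { apply (tot_app2 (fun p e x => ev c (O p e) (2 * left e) x));
      [|apply tot_id|apply tot_const].
    apply (tot_ev c O (fun _ e => 2 * left e)); [exact HO|].
    apply tot_double, tot_left, tot_id. }
  exists (fun p u => exists a r, a = table p /\ A p r /\ u = join a r).
  (* [m 1] is the first entry of the odd half, namely the answer returned by [fop f]. *)
  exists (fun m s => s = fun _ => m 1).
  split; [|split].
  - apply computable_join with (A := fun p a => a = table p); auto.
    now apply computable_fun.
  - apply (computable_fun (fun m _ => m 1)), (tot_oracle (fun _ _ => 1)), tot_const.
  - intros p x Hp Hx; destruct (H p x Hp Hx) as (r & z & Hr & Hz & Dz & Hq).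
    assert (Hval : forall q w, names q w -> f z w ->
      (exists n, table p ⟨n, pack q n⟩ <> 0) /\
      forall n v, table p ⟨n, pack q n⟩ = S v -> g x v).
    { intros q w Hw Hf; destruct (Hq q w Hw Hf) as (s & y & Hs & Hy & Hg).
      cbn in Hy; specialize (Hc _ _ Hs 0); rewrite Hy in Hc.
      assert (E : forall n, table p ⟨n, pack q n⟩ = ev c (join p q) (2 * n) 0).
      { intros n; unfold table, O; rewrite left_pair, right_pair.
        apply ev_local, join_agree; intros i; apply unpack_pack. }
      split.
      - destruct (ev_complete _ _ _ _ Hc) as [k Hk]; exists k; rewrite E.
        rewrite (ev_mono c _ k (2 * k) 0 y); auto; lia.
      - intros n v; rewrite E; intros Hv; apply ev_sound in Hv.
        now rewrite (eval_det _ _ _ _ _ Hv Hc). }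
    exists (join (table p) r), (join (table p) r : baireR).
    split; [exists (table p), r; auto|split; [reflexivity|split]].
    + destruct Dz as [w Hw]; destruct (names_surjective w) as [q Hqw].
      destruct (Hval q w Hqw Hw) as [Hn _].
      apply least_witness in Hn as (n & Hn & Hlt).
      destruct (table p ⟨n, pack q n⟩) as [|v] eqn:E; [now destruct Hn|].
      exists v, z; rewrite evens_join, odds_join; repeat split; auto.
      * now exists w.
      * intros q' w' Hq' Hw'; apply (Hval q' w' Hq' Hw').
      * exists q, w, n; repeat split; auto; intros i Hi; specialize (Hlt i Hi).
        destruct (table p ⟨i, pack q i⟩); [reflexivity|now destruct Hlt].
    + intros q v Hv (z' & Hz' & _ & _ & q' & w & n & Hq' & Hw & E & _).
      rewrite evens_join in E; rewrite odds_join in Hz'.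
      rewrite (names_functional Hz' Hz) in Hw.
      exists (fun _ => q 0), v; split; [|split; [exact Hv|now apply (proj2 (Hval q' w Hq' Hw) n)]].
      extensionality i; symmetry; apply (join_odd _ q 0).
Qed.

Lemma is_FOP_fop X Y (f : problem X Y) : is_FOP f (fop f).
Proof. split; [apply fop_le | intros; now apply le_fop]. Qed.

(** * Guessing the solutions of first-order problems below DS *)

Definition entries (j : nat) : baire := unpack (left j) (right j).
Definition last_entry (j : nat) : nat := entries j (left j - 1).

(** [a] computes the order from [p], [b] the answer from [p] and a descending
    sequence; within [s] steps, [j] is seen to code a finite descending sequence that
    determines an answer below [s]. *)
Definition valid (a b : code) (p : baire) (s j : nat) : Prop :=
  2 <= left j /\
  (forall i, S i < left j ->
    ev a p s ⟨entries j (S i), entries j i⟩ = 2 /\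
    ev a p s ⟨entries j i, entries j (S i)⟩ = 1) /\
  exists v, v < s /\ ev b (join p (entries j)) (2 * left j) 0 = S v.

(** The value [2] is the successor of the output [1], a positive answer of the order. A guess has to
    depend only on finitely many values of [p], so validity may be decided classically. *)
Fixpoint best (a b : code) (p : baire) (s m : nat) : option nat :=
  match m with
  | 0 => None
  | S m =>
      if excluded_middle_informative (valid a b p s m) then
        match best a b p s m with
        | None => Some m
        | Some j =>
            if ev a p s ⟨last_entry j, last_entry m⟩ =? 2 then Some m else Some j
        end
      else best a b p s m
  end.

(** The minimum bounds the guess at every stage; it leaves the answers of valid sequences unchanged,
    as these are below [s]. *)
Definition guess (a b : code) (p : baire) (s : nat) : nat :=
  match best a b p s s with
  | None => 0
  | Some j => Nat.min s (Nat.pred (ev b (join p (entries j)) (2 * left j) 0))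
  end.

Lemma left_le j : left j <= j.
Proof. rewrite <- (pair_left_right j) at 2; apply le_pair. Qed.

Lemma best_lt a b p s m j : best a b p s m = Some j -> j < m.
Proof.
  induction m as [|m IH]; cbn [best]; [discriminate|].
  destruct (excluded_middle_informative _).
  - destruct (best a b p s m) as [i|].
    + destruct (_ =? 2); intros [= <-]; [lia|].
      apply Nat.lt_lt_succ_r, IH; reflexivity.
    + intros [= <-]; lia.
  - intros E; specialize (IH E); lia.
Qed.

Lemma ev_join_local b p p' j s :
  j < s -> (forall k, k < s -> p k = p' k) ->
  ev b (join p (entries j)) (2 * left j) 0 = ev b (join p' (entries j)) (2 * left j) 0.
Proof.
  intros Hj E; pose proof (left_le j); apply ev_local; intros i Hi; unfold join.
  destruct (Nat.even i); [|reflexivity].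
  apply E; enough (Nat.div2 i < left j) by lia.
  rewrite Nat.div2_div; apply Nat.Div0.div_lt_upper_bound; lia.
Qed.

(** Only codes [j < s] are tried, and the answer for [j] reads [p] only below [left j <= j]. *)
Lemma guess_local a b p p' s :
  (forall k, k < s -> p k = p' k) -> guess a b p s = guess a b p' s.
Proof.
  intros E.
  assert (Ea : forall x, ev a p s x = ev a p' s x) by (intros x; now apply ev_local).
  assert (H : forall m, m <= s -> best a b p s m = best a b p' s m).
  { induction m as [|m IH]; intros Hm; cbn [best]; [reflexivity|].
    rewrite IH by lia.
    assert (Hv : valid a b p s m <-> valid a b p' s m).
    { unfold valid; rewrite (ev_join_local b p p' m s) by (auto; lia).
      now setoid_rewrite Ea. }
    destruct (excluded_middle_informative (valid a b p s m)),
      (excluded_middle_informative (valid a b p' s m)); try tauto.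
    destruct (best a b p' s m); [now rewrite Ea|reflexivity]. }
  unfold guess; rewrite H by lia.
  destruct (best a b p' s s) eqn:B; [|reflexivity].
  now rewrite (ev_join_local b p p' n s) by eauto using best_lt.
Qed.

Lemma guess_le a b p s : guess a b p s <= s.
Proof. unfold guess; destruct (best a b p s s); lia. Qed.

(** Some prefix [J] of a true descending sequence eventually becomes valid, and then the best [j]
    ends at or above the end of [J]. So the sequence coded by [j] extends to an infinite descending
    one, and its answer is correct. The guesses may still vary with [s]. *)
Lemma DS_guess X (g : problem X natR) :
  g ≤W DS -> exists gamma : baire -> nat -> nat,
    (forall p p' s, (forall k, k < s -> p k = p' k) -> gamma p s = gamma p' s) /\
    (forall p s, gamma p s <= s) /\
    forall p x, names p x -> dom g x ->
      exists m, forall s, m <= s -> g x (gamma p s).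
Proof.
  intros (A & B & [a Ha] & [b Hb] & H); exists (guess a b).
  split; [apply guess_local|split; [apply guess_le|]].
  intros p x Hp Hx; destruct (H p x Hp Hx) as (r & [L HL] & Hr & HrL & HD & Hq).
  clear H; specialize (Ha _ _ Hr); cbn in HrL.
  destruct HL as ((Hdom & Htrans) & Hanti & Htot); cbn [proj1_sig] in *.
  destruct HD as [q [Hill Hdesc]]; cbn [proj1_sig] in *.
  assert (Hans : forall q, descending L q ->
    exists v, eval b (join p q) 0 v /\ g x v).
  { intros q' D; destruct (Hq q' q' eq_refl (conj Hill D)) as (s & y & Hs & Hy & Hg).
    cbn in Hy; exists y; split; [rewrite <- Hy; now apply Hb|assumption]. }
  clear Hq Hb Hp Hx Hr.
  assert (Hev : forall s n m v, ev a p s ⟨n, m⟩ = S v -> v = Nat.b2n (L n m)).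
  { intros s n m v E; apply ev_sound in E; rewrite <- HrL.
    apply (eval_det _ _ _ _ _ E (Ha _)). }
  assert (Hconv : forall n m, exists k, forall s, k <= s ->
    ev a p s ⟨n, m⟩ = S (Nat.b2n (L n m))).
  { intros n m; destruct (ev_complete _ _ _ _ (Ha ⟨n, m⟩)) as [k Hk].
    exists k; intros s Hs; rewrite <- HrL; now apply ev_mono with k. }
  assert (Hlast : forall s j, valid a b p s j -> L (last_entry j) (last_entry j) = true).
  { intros s j (H2 & Hi & _); destruct (Hi (left j - 2)) as [E _]; [lia|].
    apply Hev in E; replace (S (left j - 2)) with (left j - 1) in E by lia.
    destruct (L (entries j (left j - 1)) (entries j (left j - 2))) eqn:E'; [|discriminate].
    now apply Hdom in E'. }
  destruct (Hans q Hdesc) as (v & Hv & _).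
  apply ev_complete in Hv as [k Hk].
  (* Length [k + 2] is at least [2], as validity demands, and makes the bound [2 * n] exceed [k]. *)
  set (n := k + 2); set (J := ⟨n, pack q n⟩).
  assert (HJl : left J = n) by apply left_pair.
  assert (HJe : forall i, i < n -> entries J i = q i).
  { intros i Hi; unfold entries, J; rewrite left_pair, right_pair.
    now apply unpack_pack. }
  destruct (bounded_uniform (fun i k => forall s, k <= s ->
      ev a p s ⟨q (S i), q i⟩ = 2 /\ ev a p s ⟨q i, q (S i)⟩ = 1) n) as [k1 Hk1].
  { intros i l l' Hl Hi s Hs; apply Hi; lia. }
  { intros i _; destruct (Hconv (q (S i)) (q i)) as [l Hl].
    destruct (Hconv (q i) (q (S i))) as [l' Hl'], (Hdesc i) as [D D'].
    exists (l + l'); intros s Hs.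
    rewrite Hl, Hl', D, D' by lia; auto. }
  (* When [best] reaches [J], the candidate so far is a code below [J]; its comparison with [J] has
     to be settled. *)
  destruct (bounded_uniform (fun j k => forall s, k <= s ->
      ev a p s ⟨last_entry j, last_entry J⟩ =
        S (Nat.b2n (L (last_entry j) (last_entry J)))) J) as [k2 Hk2].
  { intros i l l' Hl Hi s Hs; apply Hi; lia. }
  { intros i _; apply Hconv. }
  exists (S (v + J + k1 + k2)); intros s Hs.
  assert (HJ : valid a b p s J).
  { unfold valid; rewrite HJl; split; [lia|split].
    - intros i Hi; rewrite !HJe by lia; apply Hk1; lia.
    - exists v; split; [lia|].
      rewrite ev_local with (q := join p q) by now apply join_agree.
      apply ev_mono with k; [lia|assumption]. }
  assert (Hbv : forall m j, best a b p s m = Some j -> valid a b p s j).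
  { induction m as [|m IH]; intros j; cbn [best]; [discriminate|].
    destruct (excluded_middle_informative _); [|apply IH].
    destruct (best a b p s m) as [i|].
    - destruct (_ =? 2); intros [= <-]; auto.
    - intros [= <-]; auto. }
  (* At [J] totality of the order gives the claim; afterwards the candidate is replaced only by one
     whose last entry is at least as great. *)
  assert (Hbest : forall m, J < m -> exists j,
    best a b p s m = Some j /\ L (last_entry J) (last_entry j) = true).
  { induction m as [|m IH]; intros Hm; [lia|]; cbn [best].
    assert (J = m \/ J < m) as [<-|Hlt] by lia.
    - destruct (excluded_middle_informative _); [|contradiction].
      destruct (best a b p s J) as [j|] eqn:E; [|exists J; eauto].
      rewrite Hk2 by (eauto using best_lt; lia).
      destruct (L (last_entry j) (last_entry J)) eqn:E'; cbn [Nat.b2n Nat.eqb].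
      + exists J; eauto.
      + exists j; split; [reflexivity|].
        destruct (Htot _ _ (Hlast _ _ HJ) (Hlast _ _ (Hbv _ _ E))) as [D|D];
          [exact D|rewrite D in E'; discriminate].
    - destruct (IH Hlt) as (j & -> & Hj).
      destruct (excluded_middle_informative _); [|now exists j].
      destruct (_ =? 2) eqn:E; [|now exists j].
      exists m; split; [reflexivity|].
      apply Nat.eqb_eq, Hev in E.
      destruct (L (last_entry j) (last_entry m)) eqn:E'; [|discriminate]; eauto. }
  destruct (Hbest s) as (j & Ej & Hj); [lia|].
  pose proof (Hbv _ _ Ej) as (H2 & Hdj & w & Hw & Ew).
  unfold guess; rewrite Ej, Ew; cbn [Nat.pred]; rewrite Nat.min_r by lia.
  (* The sequence coded by [j], continued by the entries of [q] after those in [J]. *)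
  set (q' := fun i => if i <? left j then entries j i else q (n + (i - left j))).
  assert (Hq' : forall i, i < left j -> q' i = entries j i).
  { intros i Hi; unfold q'; apply Nat.ltb_lt in Hi; now rewrite Hi. }
  assert (Hq'' : forall i, left j <= i -> q' i = q (n + (i - left j))).
  { intros i Hi; unfold q'; apply Nat.ltb_ge in Hi; now rewrite Hi. }
  destruct (Hans q') as (y & Hy & Hg).
  { intros i.
    assert (S i < left j \/ S i = left j \/ left j <= i) as [Hi|[Hi|Hi]] by lia.
    - rewrite !Hq' by lia; destruct (Hdj i Hi) as [E E']; apply Hev in E, E'.
      destruct (L (entries j (S i)) (entries j i)); [|discriminate].
      now destruct (L (entries j i) (entries j (S i))).
    - rewrite (Hq' i), (Hq'' (S i)) by lia.
      replace (n + (S i - left j)) with (S (k + 1)) by lia.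
      replace i with (left j - 1) by lia; fold (last_entry j).
      replace (last_entry J) with (q (k + 1)) in Hj;
        [|unfold last_entry; rewrite HJe, HJl; [f_equal|]; lia].
      destruct (Hdesc (k + 1)) as [D D']; split; [now apply Htrans with (q (k + 1))|].
      apply Bool.not_true_is_false; intros E.
      now rewrite (Htrans _ _ _ Hj E) in D'.
    - rewrite !Hq'' by lia.
      replace (n + (S i - left j)) with (S (n + (i - left j))) by lia; apply Hdesc. }
  (* The run yielding [w] reads only entries coded by [j], which [q'] shares. *)
  replace w with y; [assumption|].
  apply eval_det with (1 := Hy), ev_sound with (2 * left j).
  rewrite <- Ew; apply ev_local, join_agree; auto.
Qed.

(** * Diagonalizing against a guessing procedure *)

Definition order_name (R : nat -> nat -> bool) : baire :=
  fun k => Nat.b2n (R (left k) (right k)).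

Lemma order_name_spec R : char_fun (order_name R) R.
Proof. intros n m; unfold order_name; now rewrite left_pair, right_pair. Qed.

Fixpoint find_index (f : nat -> bool) (l : list nat) : nat :=
  match l with
  | nil => 0
  | a :: l => if f a then 0 else S (find_index f l)
  end.

Lemma find_index_spec f l :
  (exists a, In a l /\ f a = true) ->
  find_index f l < length l /\ f (nth (find_index f l) l 0) = true.
Proof.
  induction l as [|a l IH]; intros (x & Hx & Fx); [destruct Hx|].
  cbn [find_index length]; destruct (f a) eqn:E; [cbn; auto with arith|].
  destruct Hx as [->|Hx]; [congruence|].
  destruct IH; [eauto|]; cbn [nth]; auto with arith.
Qed.

(** An order on the numbers up to [3 * s], all values at larger numbers being junk,
    and the list of its leaves in order of decreasing priority; every number up to
    [3 * s] is below some leaf. *)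
Definition state : Type := (nat -> nat -> bool) * list nat.

Section Adversary.

Context (gamma : baire -> nat -> nat).

Definition position (s : nat) (st : state) : nat :=
  find_index (fst st (gamma (order_name (fst st)) s)) (snd st).

(** Leaf [i] is split by placing [3 * s + 1] and [3 * s + 2] incomparably above it; [3 * s + 3]
    merges [3 * s + 2] with all leaves of lower priority. *)
Definition step (s : nat) (st : state) : state :=
  let i := position s st in
  (fun x w =>
     if w <=? 3 * s then fst st x w
     else (x =? w) || fst st x (nth i (snd st) 0) ||
       ((w =? 3 * s + 3) &&
          ((x =? 3 * s + 2) || existsb (fst st x) (skipn (S i) (snd st)))),
   firstn i (snd st) ++ 3 * s + 1 :: 3 * s + 3 :: nil)%bool.

Fixpoint run (s : nat) : state :=
  match s with
  | 0 => (Nat.eqb, 0 :: nil)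
  | S s => step s (run s)
  end.

Definition leaves (s : nat) : list nat := snd (run s).
Definition leaf (s i : nat) : nat := nth i (leaves s) 0.
(** The column of [w] no longer changes once [w <= 3 * s], so stage [w] is late enough to read
    it. *)
Definition limit (x w : nat) : bool := fst (run w) x w.
Definition guessed (s : nat) : nat := gamma (order_name limit) s.
Definition index (s : nat) : nat := position s (run s).

(** * The limit quasi-order *)

Lemma run_limit s x w : w <= 3 * s -> fst (run s) x w = limit x w.
Proof.
  assert (H : forall d n, w <= 3 * n -> fst (run (d + n)) x w = fst (run n) x w).
  { induction d as [|d IH]; intros n Hn; [reflexivity|].
    rewrite <- (IH n Hn); cbn [Nat.add run step fst].
    replace (w <=? 3 * (d + n)) with true; [reflexivity|].
    symmetry; apply Nat.leb_le; lia. }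
  intros Hs; unfold limit; rewrite <- (H w s Hs), <- (H s w) by lia.
  now rewrite Nat.add_comm.
Qed.

Lemma leaves_le s l : In l (leaves s) -> l <= 3 * s.
Proof.
  revert l; induction s as [|s IH]; intros l.
  - intros [<-|[]]; lia.
  - unfold leaves; cbn [run step snd]; rewrite in_app_iff.
    intros [H|[<-|[<-|[]]]]; [|lia|lia].
    enough (l <= 3 * s) by lia; apply IH; unfold leaves.
    rewrite <- (firstn_skipn (position s (run s)) (snd (run s))); apply in_app_iff; auto.
Qed.

Lemma leaf_le s i : leaf s i <= 3 * s.
Proof.
  unfold leaf; destruct (nth_in_or_default i (leaves s) 0) as [H| ->]; [|lia].
  now apply leaves_le.
Qed.

(** Reduces comparisons with a new element to comparisons with leaves at most [3 * s], which makes
    induction on the upper element possible. *)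
Lemma limit_spec s x w : 3 * s < w <= 3 * s + 3 ->
  limit x w = true <->
  x = w \/ limit x (leaf s (index s)) = true \/
  w = 3 * s + 3 /\
    (x = 3 * s + 2 \/
     exists j, index s < j < length (leaves s) /\ limit x (leaf s j) = true).
Proof.
  intros Hw; rewrite <- (run_limit (S s)) by lia; cbn [run step fst].
  replace (w <=? 3 * s) with false by (symmetry; apply Nat.leb_gt; lia).
  fold (index s) (leaves s) (leaf s (index s)).
  rewrite run_limit by apply leaf_le.
  rewrite !Bool.orb_true_iff, Bool.andb_true_iff, Bool.orb_true_iff, existsb_exists.
  rewrite !Nat.eqb_eq, or_assoc.
  enough ((exists l, In l (skipn (S (index s)) (leaves s)) /\
      fst (run s) x l = true) <->
    (exists j, index s < j < length (leaves s) /\ limit x (leaf s j) = true)) by tauto.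
  split.
  - intros (l & Hl & E); apply (In_nth _ _ 0) in Hl as (j & Hj & <-).
    rewrite nth_skipn in E; rewrite length_skipn in Hj.
    exists (S (index s) + j); split; [lia|].
    now rewrite run_limit in E by apply leaf_le.
  - intros (j & Hj & E); exists (leaf s j).
    rewrite run_limit by apply leaf_le; split; [|assumption].
    replace j with (S (index s) + (j - S (index s))) by lia.
    unfold leaf; rewrite <- nth_skipn; apply nth_In; rewrite length_skipn; lia.
Qed.

Lemma limit_0 x : limit x 0 = true <-> x = 0.
Proof. apply Nat.eqb_eq. Qed.

Lemma stage_of w : w = 0 \/ exists s, 3 * s < w <= 3 * s + 3.
Proof.
  destruct w as [|w]; [auto|right]; exists (w / 3).
  pose proof (Nat.div_mod_eq w 3); pose proof (Nat.mod_upper_bound w 3); lia.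
Qed.

Lemma limit_refl x : limit x x = true.
Proof.
  destruct (stage_of x) as [->|[s Hs]]; [reflexivity|].
  apply (limit_spec s); auto.
Qed.

(** Nothing new is ever put below an older element. *)
Lemma limit_le x w : limit x w = true -> x <= w.
Proof.
  induction w as [w IH] using (well_founded_induction lt_wf).
  destruct (stage_of w) as [->|[s Hs]]; [rewrite limit_0; lia|].
  rewrite (limit_spec s) by assumption.
  pose proof (leaf_le s) as Hl.
  intros [->|[E|(-> & [->|(j & Hj & E)])]]; [lia| |lia|];
    apply IH in E; try pose proof (Hl (index s)); try pose proof (Hl j); lia.
Qed.

Lemma limit_trans x y w : limit x y = true -> limit y w = true -> limit x w = true.
Proof.
  revert y; induction w as [w IH] using (well_founded_induction lt_wf); intros y Hxy.
  destruct (stage_of w) as [->|[s Hs]]; [rewrite limit_0; intros ->; assumption|].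
  pose proof (leaf_le s) as Hl.
  rewrite (limit_spec s y), (limit_spec s x) by assumption.
  intros [->|[E|(-> & [->|(j & Hj & E)])]].
  - now apply (limit_spec s).
  - right; left; apply (IH _) with y; auto.
    pose proof (Hl (index s)); lia.
  (* Here [y = 3 * s + 2] and [w = 3 * s + 3]: below [y] lie only [y] itself and what is below the
     split leaf. *)
  - apply (limit_spec s) in Hxy; [|lia].
    destruct Hxy as [->|[E|[E _]]]; [|auto|lia].
    right; right; auto.
  - right; right; split; [reflexivity|right; exists j; split; [assumption|]].
    apply (IH _) with y; auto; pose proof (Hl j); lia.
Qed.

Lemma limit_quasi_order : quasi_order limit.
Proof.
  split; [intros; split; apply limit_refl|exact limit_trans].
Qed.

(** * Guesses and leaves *)

Hypothesis gamma_local : forall p p' s,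
  (forall k, k < s -> p k = p' k) -> gamma p s = gamma p' s.
Hypothesis gamma_le : forall p s, gamma p s <= s.

(** Both components of the pair coded by [k] are at most [k], so the part of the name read at stage
    [s] is already final. *)
Lemma guessed_run s : gamma (order_name (fst (run s))) s = guessed s.
Proof.
  apply gamma_local; intros k Hk; unfold order_name.
  rewrite run_limit; [reflexivity|].
  pose proof (le_pair (left k) (right k)) as H; rewrite pair_left_right in H; lia.
Qed.

(** As the guess is at most [s], it is covered and the search for a leaf above it succeeds. Covering
    is a hypothesis here because the induction that proves it uses this lemma. *)
Lemma index_spec s :
  (forall x, x <= 3 * s -> exists l, In l (leaves s) /\ limit x l = true) ->
  index s < length (leaves s) /\ limit (guessed s) (leaf s (index s)) = true.
Proof.
  intros H; unfold leaf.
  assert (E : index s = find_index (limit (guessed s)) (leaves s)).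
  { unfold index, position; rewrite guessed_run; fold (leaves s).
    pose proof (leaves_le s) as Hl; clear H; revert Hl.
    induction (leaves s) as [|a l IH]; intros Hl; [reflexivity|].
    cbn [find_index]; rewrite run_limit by (apply Hl; left; reflexivity).
    rewrite IH; [reflexivity|]; intros; apply Hl; now right. }
  rewrite E; apply find_index_spec, H.
  unfold guessed; pose proof (gamma_le (order_name limit) s); lia.
Qed.

Lemma leaves_succ s :
  leaves (S s) = firstn (index s) (leaves s) ++ 3 * s + 1 :: 3 * s + 3 :: nil.
Proof. reflexivity. Qed.

(** A leaf that disappears was either split or merged, and in both cases lies below [3 * s + 3]. *)
Lemma leaves_cover s x : x <= 3 * s -> exists l, In l (leaves s) /\ limit x l = true.
Proof.
  revert x; induction s as [|s IH]; intros x Hx.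
  - exists 0; replace x with 0 by lia; split; [now left|reflexivity].
  - destruct (index_spec s IH) as [Hi _]; rewrite leaves_succ.
    assert (Hz : forall x, x = 3 * s + 2 \/ x = 3 * s + 3 \/
      (exists j, index s <= j < length (leaves s) /\ limit x (leaf s j) = true) ->
      limit x (3 * s + 3) = true).
    { intros y Hy; apply (limit_spec s); [lia|].
      destruct Hy as [->|[->|(j & Hj & E)]]; auto.
      assert (j = index s \/ index s < j) as [->|] by lia; auto.
      right; right; split; [reflexivity|right; exists j; split; [lia|assumption]]. }
    assert (x <= 3 * s \/ x = 3 * s + 1 \/ x = 3 * s + 2 \/ x = 3 * s + 3)
      as [Hs|[->|Hs]] by lia.
    + destruct (IH x Hs) as (l & Hl & E).
      apply (In_nth _ _ 0) in Hl as (j & Hj & <-).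
      destruct (Nat.lt_ge_cases j (index s)) as [L|L].
      * exists (nth j (leaves s) 0); split; [|assumption].
        apply in_app_iff; left.
        apply Nat.ltb_lt in L as L'.
        replace (nth j (leaves s) 0) with (nth j (firstn (index s) (leaves s)) 0)
          by now rewrite nth_firstn, L'.
        apply nth_In; rewrite length_firstn; lia.
      * exists (3 * s + 3); split; [apply in_app_iff; right; cbn; auto|].
        apply Hz; right; right; exists j; auto.
    + exists (3 * s + 1); split; [apply in_app_iff; right; cbn; auto|apply limit_refl].
    + exists (3 * s + 3); split; [apply in_app_iff; right; cbn; auto|].
      apply Hz; tauto.
Qed.

Lemma index_lt s : index s < length (leaves s).
Proof. apply index_spec, leaves_cover. Qed.

Lemma guessed_le_leaf s : limit (guessed s) (leaf s (index s)) = true.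
Proof. apply index_spec, leaves_cover. Qed.

Lemma leaves_succ_cases s j : j < length (leaves (S s)) ->
  j < index s /\ leaf (S s) j = leaf s j \/
  j = index s /\ leaf (S s) j = 3 * s + 1 \/
  j = S (index s) /\ leaf (S s) j = 3 * s + 3.
Proof.
  pose proof (index_lt s) as Hi; unfold leaf; rewrite leaves_succ, length_app.
  assert (Hf : length (firstn (index s) (leaves s)) = index s)
    by (rewrite length_firstn; lia).
  rewrite Hf; cbn [length]; intros Hj.
  destruct (Nat.lt_ge_cases j (index s)) as [L|L].
  - left; split; [assumption|]; rewrite app_nth1, nth_firstn by lia.
    apply Nat.ltb_lt in L; now rewrite L.
  - right; rewrite app_nth2, Hf by lia.
    assert (j = index s \/ j = S (index s)) as [->| ->] by lia; [left|right].
    + now rewrite Nat.sub_diag.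
    + now rewrite Nat.sub_succ_l, Nat.sub_diag by lia.
Qed.

(** * True stages *)

Definition true_stage (s : nat) : Prop := forall t, s <= t -> index s <= index t.

(** A stage of least index among those from [m] on is true. *)
Lemma true_stage_exists m : exists s, m <= s /\ true_stage s.
Proof.
  destruct (least_witness (fun i => exists s, m <= s /\ index s = i))
    as (i & (s & Hs & <-) & H); [now exists (index m), m|].
  exists s; split; [assumption|]; intros t Ht.
  destruct (Nat.lt_ge_cases (index t) (index s)) as [L|L]; [|assumption].
  exfalso; apply (H _ L); exists t; split; [lia|reflexivity].
Qed.

(** Splits after a true stage happen at or beyond its position, so all leaves from this position on
    stay above the leaf split then. Every later element is put above one of them. *)
Lemma true_stage_above s w : true_stage s -> 3 * s < w -> limit (guessed s) w = true.
Proof.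
  intros Hs Hw; set (l := leaf s (index s)).
  apply limit_trans with l; [apply guessed_le_leaf|].
  assert (Hnew : forall t v, s <= t -> 3 * t < v <= 3 * t + 3 ->
    limit l (leaf t (index t)) = true -> limit l v = true).
  { intros t v _ Hv E; apply (limit_spec t); auto. }
  assert (H : forall d j, index s <= j < length (leaves (S (d + s))) ->
    limit l (leaf (S (d + s)) j) = true).
  { induction d as [|d IH]; intros j [Hj Hj'].
    - destruct (leaves_succ_cases _ _ Hj') as [[L _]|[[_ ->]|[_ ->]]];
        [cbn in L; lia| |]; apply (Hnew s); try lia; apply limit_refl.
    - pose proof (Hs (S d + s)) as Ht.
      destruct (leaves_succ_cases _ _ Hj') as [[L ->]|[[_ ->]|[_ ->]]].
      + apply IH; pose proof (index_lt (S d + s)); cbn [Nat.add] in *; lia.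
      + apply (Hnew (S d + s)); try lia.
        apply IH; pose proof (index_lt (S d + s)); cbn [Nat.add] in *; lia.
      + apply (Hnew (S d + s)); try lia.
        apply IH; pose proof (index_lt (S d + s)); cbn [Nat.add] in *; lia. }
  destruct (stage_of w) as [->|[t Ht]]; [lia|].
  assert (s <= t) by lia; apply (Hnew t w); auto.
  destruct (Nat.eq_dec s t) as [<-|]; [apply limit_refl|].
  replace t with (S ((t - S s) + s)) by lia; apply H; split.
  - apply Hs; lia.
  - apply index_lt.
Qed.

(** A bad sequence starting at the guess would be confined to numbers up to [3 * s], but bad
    sequences are injective. *)
Lemma true_stage_not_bad s q : true_stage s -> bad limit q -> q 0 <> guessed s.
Proof.
  intros Hs [_ Hq] E.
  assert (Hle : forall i, q (S i) <= 3 * s).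
  { intros i; destruct (Nat.lt_ge_cases (3 * s) (q (S i))) as [L|L]; [|assumption].
    apply true_stage_above in L; [|assumption]; rewrite <- E, Hq in L; lia || discriminate. }
  assert (Hinj : forall i j, q i = q j -> i = j).
  { intros i j Eij; destruct (Nat.lt_trichotomy i j) as [L|[L|L]]; auto;
      apply Hq in L; rewrite Eij, limit_refl in L; discriminate. }
  (* These are [3 * s + 2] distinct entries among [3 * s + 1] numbers. *)
  set (l := map q (seq 1 (3 * s + 2))).
  assert (Hl : NoDup l).
  { apply NoDup_map_NoDup_ForallPairs; [|apply seq_NoDup].
    intros i j _ _; apply Hinj. }
  assert (Hincl : incl l (seq 0 (3 * s + 1))).
  { intros x Hx; apply in_map_iff in Hx as (i & <- & Hi); apply in_seq in Hi.
    apply in_seq; specialize (Hle (i - 1)).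
    replace (S (i - 1)) with i in Hle by lia; lia. }
  apply NoDup_incl_length in Hincl; [|assumption].
  unfold l in Hincl; rewrite length_map, !length_seq in Hincl; lia.
Qed.

(** * Existence of a bad sequence in the limit order *)

Lemma bad_of_unbounded (P : nat -> Prop) (w : nat -> nat) :
  (forall m, exists s, m <= s /\ P s) ->
  (forall s t, P s -> s < t -> P t -> limit (w s) (w t) = false) ->
  exists q, bad limit q.
Proof.
  intros Hunb Hw.
  set (next := fun m => proj1_sig (constructive_indefinite_description _ (Hunb m))).
  assert (Hnext : forall m, m <= next m /\ P (next m)).
  { intros m; unfold next; now destruct (constructive_indefinite_description _ _). }
  set (u := nat_rect (fun _ => nat) (next 0) (fun _ v => next (S v))).
  assert (Hu : forall n, P (u n)) by (intros [|n]; apply Hnext).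
  assert (Hmono : forall i j, i < j -> u i < u j).
  { intros i j; induction j as [|j IH]; intros L; [lia|].
    pose proof (proj1 (Hnext (S (u j)))) as H; change (S (u j) <= u (S j)) in H.
    assert (i = j \/ i < j) as [->|L'] by lia; [lia|specialize (IH L'); lia]. }
  exists (fun n => w (u n)); split; [intros; apply limit_refl|].
  intros i j L; apply Hw; auto.
Qed.

(** Here the [i]-th leaves form an increasing chain, from which the elements
    [3 * s + 2] branch off. *)
Lemma recurrent_index_bad i n :
  (forall s, n <= s -> i <= index s) ->
  (forall m, exists s, m <= s /\ (n <= s /\ index s = i)) ->
  exists q, bad limit q.
Proof.
  intros Hn Hinf.
  apply (bad_of_unbounded _ (fun s => 3 * s + 2) Hinf).
  intros s t [Hs Es] Hst [Ht Et]; apply Bool.not_true_is_false.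
  (* The [i]-th leaf starts as [3 * s + 1] and changes only when it is split, to a new element with
     nothing but the old leaf directly below it; so it never gets above [3 * s + 2]. *)
  assert (H : forall d, limit (3 * s + 2) (leaf (S (d + s)) i) <> true).
  { induction d as [|d IH]; intros E.
    - destruct (leaves_succ_cases s i) as [[L _]|[[_ E']|[L _]]]; try lia.
      + rewrite leaves_succ, length_app, length_firstn; pose proof (index_lt s).
        cbn [length]; lia.
      + cbn [Nat.add] in E; rewrite E' in E; apply limit_le in E; lia.
    - assert (Hi : i <= index (S d + s)) by (apply Hn; lia).
      destruct (leaves_succ_cases (S d + s) i) as [[L E']|[[L E']|[L _]]]; try lia.
      + rewrite leaves_succ, length_app, length_firstn.
        pose proof (index_lt (S d + s)); cbn [length]; lia.
      + change (S (S d + s)) with (S (S (d + s))) in E'.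
        cbn [Nat.add] in E, E'; rewrite E' in E; auto.
      + cbn [Nat.add] in E, E', L; rewrite E' in E.
        apply (limit_spec (S (d + s))) in E; [|lia].
        rewrite <- L in E.
        destruct E as [E|[E|[E _]]]; [lia|auto|lia]. }
  rewrite (limit_spec t) by lia; rewrite Et.
  specialize (H (t - S s)); replace (S (t - S s + s)) with t in H by lia.
  intros [E|[E|[E _]]]; [lia|auto|lia].
Qed.

(** Here [3 * s + 1] remains a leaf for ever. *)
Lemma transient_index_bad :
  (forall m, exists s, m <= s /\ forall t, s < t -> index s < index t) ->
  exists q, bad limit q.
Proof.
  intros Hinf.
  apply (bad_of_unbounded _ (fun s => 3 * s + 1) Hinf).
  intros s t Hs Hst _; apply Bool.not_true_is_false.
  (* No leaf away from position [index s] gets above [3 * s + 1], because later stages split and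
     merge only leaves beyond this position. *)
  assert (H : forall d j, j < length (leaves (S (d + s))) -> j <> index s ->
    limit (3 * s + 1) (leaf (S (d + s)) j) <> true).
  { assert (Hold : forall j, limit (3 * s + 1) (leaf s j) <> true).
    { intros j E; apply limit_le in E; pose proof (leaf_le s j); lia. }
    induction d as [|d IH]; intros j Hj Hne E; cbn [Nat.add] in *.
    - destruct (leaves_succ_cases s j Hj) as [[L E']|[[L _]|[_ E']]];
        [rewrite E' in E; now apply Hold in E|lia|].
      rewrite E', (limit_spec s) in E by lia.
      destruct E as [E|[E|(_ & [E|(j' & _ & E)])]]; try lia; now apply Hold in E.
    - assert (Hi : index s < index (S (d + s))) by (apply Hs; lia).
      pose proof (index_lt (S (d + s))).
      destruct (leaves_succ_cases _ j Hj) as [[L E']|[[L E']|[L E']]];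
        rewrite E' in E; [apply (IH j); auto; lia| |];
        apply (limit_spec (S (d + s))) in E; try lia;
        destruct E as [E|[E|(_ & [E|(j' & Hj' & E)])]]; try lia.
      + apply (IH (index (S (d + s)))); auto; lia.
      + apply (IH j'); auto; lia.
      + apply (IH (index (S (d + s)))); auto; lia.
      + apply (IH j'); auto; lia. }
  rewrite (limit_spec t) by lia.
  assert (index s < index t) by auto; pose proof (index_lt t).
  specialize (H (t - S s) (index t)); replace (S (t - S s + s)) with t in H by lia.
  intros [E|[E|[E _]]]; [lia|apply H; auto; lia|lia].
Qed.

(** Either infinitely many stages have an index that is exceeded ever after, or from some stage on
    none has. In the second case the index of a true stage recurs for ever. *)
Lemma limit_bad : exists q, bad limit q.
Proof.
  destruct (classic (forall m, exists s, m <= s /\ forall t, s < t -> index s < index t))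
    as [H|H]; [now apply transient_index_bad|].
  apply not_all_ex_not in H as [m Hm].
  assert (Hret : forall s, m <= s -> exists t, s < t /\ index t <= index s).
  { intros s Hs; apply NNPP; intros N; apply Hm; exists s; split; [assumption|].
    intros t Ht; destruct (Nat.lt_ge_cases (index s) (index t)) as [L|L]; [assumption|].
    exfalso; apply N; now exists t. }
  destruct (true_stage_exists m) as (s & Hs & Ts).
  apply recurrent_index_bad with (index s) s; [exact Ts|].
  intros k; induction k as [|k (t & Hk & Ht & E)]; [exists s; auto with arith|].
  destruct (Hret t) as (t' & L & E'); [lia|]; exists t'.
  assert (index s <= index t') by (apply Ts; lia); lia.
Qed.

End Adversary.

(** * The separation *)

(** Serves as the first-order problem that reduces to [BS] but not to [DS]. *)
Definition bad_start : problem QO natR :=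
  fun Q x => exists q, bad (proj1_sig Q) q /\ q 0 = x.

Lemma bad_start_le_BS : bad_start ≤W BS.
Proof.
  exists (fun p r => r = p), (fun m s => s = odds m).
  split; [apply computable_fun, (tot_oracle (fun _ n => n)), tot_id|split].
  { apply computable_fun, tot_odds. }
  intros p Q Hp (_ & q & Hq & _); exists p, Q.
  assert (Hw : ~ wqo (proj1_sig Q)) by (intros [_ H]; apply H; now exists q).
  split; [reflexivity|split; [assumption|split; [now exists q|]]].
  intros r w Hr [_ Hbad]; cbn in Hr; subst w.
  (* [r] itself names its first entry in [natR]. *)
  exists r, (r 0 : natR); rewrite odds_join; repeat split; now exists r.
Qed.

(** From some stage on all guesses would have to start bad sequences, but a true stage occurs later
    still. *)
Lemma bad_start_not_le_DS : ~ bad_start ≤W DS.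
Proof.
  intros H; apply DS_guess in H as (gamma & Hloc & Hle & H).
  set (Q := exist _ (limit gamma) (limit_quasi_order gamma) : QO).
  destruct (limit_bad gamma Hloc Hle) as [q Hq].
  destruct (H (order_name (limit gamma)) Q) as [m Hm].
  { apply order_name_spec. }
  { now exists (q 0), q. }
  destruct (true_stage_exists gamma m) as (s & Hs & Ts).
  destruct (Hm s Hs) as (q' & Hq' & E).
  now apply (true_stage_not_bad gamma Hloc Hle s q' Ts Hq').
Qed.

(** Forwards by transitivity, backwards by totality. Hence [DS] is [BS] restricted to linear
    orders. *)
Lemma descending_bad L s : linear_order L -> descending L s <-> bad L s.
Proof.
  intros ((Hdom & Htrans) & _ & Htot); split.
  - intros H.
    assert (Hlt : forall i j, i < j -> L (s j) (s i) = true).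
    { intros i j; induction j as [|j IH]; intros Hij; [lia|].
      assert (i = j \/ i < j) as [->|Hij'] by lia; [apply H|].
      apply Htrans with (s j); [apply H|auto]. }
    split; [intros i; apply (Hdom (s (S i)) (s i)), Hlt; lia|].
    intros i j Hij; apply Bool.not_true_is_false; intros E.
    assert (E' : L (s i) (s (S i)) = true).
    { assert (j = S i \/ S i < j) as [->|Hj] by lia; [assumption|eauto]. }
    destruct (H i); congruence.
  - intros [Hr Hb] i; specialize (Hb i (S i) (Nat.lt_succ_diag_r i)).
    destruct (Htot _ _ (Hr i) (Hr (S i))); [congruence|now split].
Qed.

Lemma DS_le_BS : DS ≤W BS.
Proof.
  exists (fun p r => r = p), (fun m s => s = odds m).
  split; [apply computable_fun, (tot_oracle (fun _ n => n)), tot_id|split].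
  { apply computable_fun, tot_odds. }
  intros p [L HL] Hp (s & Hill & Hs); cbn in Hp, Hill, Hs.
  exists p, (exist _ L (proj1 HL) : QO).
  assert (Hw : ~ wqo L).
  { intros [_ H]; apply H; exists s; now apply descending_bad. }
  split; [reflexivity|split; [assumption|split]].
  - exists s; split; [assumption|now apply descending_bad].
  - intros q w Hq [_ Hb]; exists q, (q : baireR); rewrite odds_join.
    split; [reflexivity|split; [reflexivity|split; [assumption|]]].
    cbn in Hq, Hb; subst w; now apply descending_bad.
Qed.

Theorem theorem3p1 :
  (exists (X : rep_space) (F : problem X natR), is_FOP BS F) /\
  (exists (Y : rep_space) (G : problem Y natR), is_FOP DS G) /\
  (forall (X Y : rep_space) (F : problem X natR) (G : problem Y natR),
     is_FOP BS F -> is_FOP DS G -> ~ F ≤W G) /\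
  DS <W BS.
Proof.
  split; [exists baireR, (fop BS); apply is_FOP_fop|].
  split; [exists baireR, (fop DS); apply is_FOP_fop|].
  split; [|split; [exact DS_le_BS|]].
  - intros X Y F G [_ HF] [HG _] H; apply bad_start_not_le_DS.
    (* [bad_start] lies below [F] by maximality, and [F] lies below [G], hence below [DS]. *)
    apply (weihrauch_le_trans _ _ _ _ _ _ _ F); [exact (HF _ _ bad_start_le_BS)|].
    exact (weihrauch_le_trans _ _ _ _ _ _ _ _ _ H HG).
  - intros H; apply bad_start_not_le_DS.
    exact (weihrauch_le_trans _ _ _ _ _ _ _ _ _ bad_start_le_BS H).
Qed.
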